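(* Let $A$ be a finite dimensional commutative unital local $K$-algebra with a fixed augmentation $\epsilon$ and maximal ideal $\mathsf m$, let $\lambda$ be a deformation of a dialgebra $D$ with base $A$, and let $0\to K\xrightarrow{i}B\xrightarrow{p}A\to0$ be an extension of $A$ corresponding to a cohomology class $f\in H^2_{Harr}(A;K)$. The operation of $HY^2(D,D)$ on the set of equivalence classes of deformations $\mu$ of $D$ with base $B$ such that $p_*\mu=\lambda$, and the operation $\mu\mapsto r_*\mu$ on this set of the group of automorphisms $r$ of the extension, are related by the differential $d\lambda:TA\to HY^2(D,D)$. In other words: if $r:B\to B$ determines an automorphism of the extension $0\to K\xrightarrow{i}B\xrightarrow{p}A\to0$ which corresponds to an element $h\in H^1_{Harr}(A;K)=TA$, then for any deformation $\mu$ of $D$ with base $B$ such that $p_*\mu=\lambda$, the difference between the push-out $r_*\mu$ and $\mu$ is a cocycle of the cohomology class $d\lambda(h)$.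
   Context: $K$ is a field of characteristic zero; tensor products are over $K$ unless indicated; $'$ denotes the $K$-linear dual. Dialgebra: a $K$-vector space $D$ with two $K$-bilinear products $\dashv,\vdash$ such that for all $x,y,z$: $x\dashv(y\dashv z)=(x\dashv y)\dashv z=x\dashv(y\vdash z)$; $(x\vdash y)\dashv z=x\vdash(y\dashv z)$; $(x\dashv y)\vdash z=x\vdash(y\vdash z)=(x\vdash y)\vdash z$. Trees: $Y_n$ is the set of planar binary rooted trees with $n$ trivalent vertices and $n+1$ leaves labelled $0,\dots,n$ from left to right; $Y_0=\{|\}$, and $|$ is denoted $[0]$; $[1]$ is the unique element of $Y_1$. The grafting $y_1\vee y_2$ of a $p$-tree and a $q$-tree joins their roots to a new root; it is denoted $[y_1\; p{+}q{+}1\; y_2]$ with zeros deleted. Thus $[12]=[1]\vee|$, $[21]=|\vee[1]$. The face map $d_i:Y_n\to Y_{n-1}$ deletes the $i$-th leaf. Cohomology: $CY^n(D,D)=\mathrm{Hom}_K(K[Y_n]\otimes D^{\otimes n},D)$, with coboundary $\delta=\sum_{i=0}^{n+1}(-1)^i\delta^i$, where for $y\in Y_{n+1}$: $(\delta^0f)(y;a_1,\dots,a_{n+1})=a_1\circ_0^y f(d_0y;a_2,\dots,a_{n+1})$; $(\delta^if)(y;a_1,\dots,a_{n+1})=f(d_iy;a_1,\dots,a_i\circ_i^ya_{i+1},\dots,a_{n+1})$ for $1\le i\le n$; $(\delta^{n+1}f)(y;a_1,\dots,a_{n+1})=f(d_{n+1}y;a_1,\dots,a_n)\circ_{n+1}^ya_{n+1}$.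 Here $\circ_0^y=\dashv$ if $y=|\vee y_1$ for some $y_1$, and $\vdash$ otherwise; for $1\le i\le n$, $\circ_i^y=\dashv$ if the $i$-th leaf is oriented like $\backslash$ and $\vdash$ if it is oriented like $/$; $\circ_{n+1}^y=\vdash$ if $y=y_1\vee|$ for some $y_1$, and $\dashv$ otherwise. $HY^n(D,D)$ is the resulting cohomology. Deformations: let $A$ be a commutative unital $K$-algebra with augmentation $\epsilon:A\to K$, $\epsilon(1)=1$. A deformation $\lambda$ of $D$ with base $A$ is a dialgebra structure on $A\otimes D$ with $A$-bilinear products $\dashv_\lambda,\vdash_\lambda$ such that $\epsilon\otimes\mathrm{id}:A\otimes D\to D$ is a dialgebra morphism. Two deformations with the same base $A$ are equivalent if there is an $A$-linear dialgebra isomorphism between them compatible with $\epsilon\otimes\mathrm{id}$. For a unital homomorphism $\phi:A\to A'$ with $\epsilon'\circ\phi=\epsilon$, the push-out $\phi_*\lambda$ is the deformation with base $A'$ on $A'\otimes D=A'\otimes_A(A\otimes D)$ given by $(a_1'\otimes_A l_1)*_{\phi_*\lambda}(a_2'\otimes_A l_2)=a_1'a_2'\otimes_A(l_1*_\lambda l_2)$, $*\in\{\dashv,\vdash\}$. Extensions: $K$ is an $A$-module via $\epsilon$. Elements of the Harrison cohomology $H^2_{Harr}(A;K)$ are in bijection with isomorphism classes of extensions $0\to K\xrightarrow{i}B\xrightarrow{p}A\to0$ of commutative algebras with $b\,i(k)=i(\epsilon(p(b))k)$. Then $B$ is local and unital, with augmentation $\widehat\epsilon=\epsilon\circ p$.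 An automorphism of the extension is a $K$-algebra automorphism $r$ of $B$ with $r\circ i=i$ and $p\circ r=p$. $H^1_{Harr}(A;K)$ is the space of derivations $A\to K$, identified with the tangent space $TA=(\mathsf m/\mathsf m^2)'$; the automorphism corresponding to a derivation $h$ is $r(b)=b+i(h(p(b)))$. The operation of $HY^2(D,D)$: put $I=i\otimes\mathrm{id}:D\to B\otimes D$ and $E=\widehat\epsilon\otimes\mathrm{id}:B\otimes D\to D$. For two deformations $\mu,\mu_1$ with base $B$ and $p_*\mu=p_*\mu_1=\lambda$, the difference between $\mu_1$ and $\mu$ is the cochain $\psi\in CY^2(D,D)$ with $l_1\dashv_{\mu_1}l_2-l_1\dashv_\mu l_2=I\psi([21];E(l_1),E(l_2))$ and $l_1\vdash_{\mu_1}l_2-l_1\vdash_\mu l_2=I\psi([12];E(l_1),E(l_2))$ for $l_1,l_2\in B\otimes D$; the class of a cocycle $\psi$ sends the class of $\mu$ to the class of the deformation $\mu_1$ with difference $\psi$ from $\mu$. Differential: for a deformation $\kappa$ with local base $R$ whose maximal ideal $\mathsf m_R$ has square zero, and $\xi\in\mathsf m_R'$ extended to $R$ by $\xi(1)=0$, let $\alpha_{\kappa,\xi}\in CY^2(D,D)$ be the cocycle $\alpha_{\kappa,\xi}([21];x_1,x_2)=(\xi\otimes\mathrm{id})((1\otimes x_1)\dashv_\kappa(1\otimes x_2))$, $\alpha_{\kappa,\xi}([12];x_1,x_2)=(\xi\otimes\mathrm{id})((1\otimes x_1)\vdash_\kappa(1\otimes x_2))$, and let $a_\kappa(\xi)\in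 HY^2(D,D)$ be its class. With $\pi:A\to A/\mathsf m^2$ the projection, $d\lambda=a_{\pi_*\lambda}:TA\to HY^2(D,D)$. *)

(* Defs.v *)
From HB Require Import structures.
From mathcomp Require Import all_boot all_algebra all_field.
From mathcomp Require Import generic_quotient ring_quotient sesquilinear.
From mathcomp Require Import boolp.
From mathcomp Require Import finmap monalg.

Set Implicit Arguments.
Unset Strict Implicit.
Unset Printing Implicit Defensive.

Import GRing.Theory.
Local Open Scope ring_scope.
Local Open Scope quotient_scope.

Section QuotScale.
Variables (K : nzRingType) (V : lmodType K) (S : zmodClosed V).
Hypothesis SZ : forall c v, v \in S -> c *: v \in S.
Local Notation Q := {ideal_quot S}.

Definition quot_scale (c : K) : Q -> Q := lift_op1 Q ( *:%R c).

Lemma pi_scale c : {morph \pi_Q : x / c *: x >-> quot_scale c x}.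
Proof.
move=> x; unlock quot_scale; apply/eqP; rewrite -Quotient.idealrBE -scalerBr.
by apply: SZ; rewrite Quotient.idealrBE reprK.
Qed.

Lemma quot_piD : {morph \pi_Q : x y / x + y >-> x + y}.
Proof. exact: Quotient.pi_add. Qed.

Lemma quot_scalerA a b (v : Q) :
  quot_scale a (quot_scale b v) = quot_scale (a * b) v.
Proof. by elim/quotW: v => v; rewrite -!pi_scale scalerA. Qed.

Lemma quot_scale1r : left_id 1 quot_scale.
Proof. by elim/quotW => v; rewrite -pi_scale scale1r. Qed.

Lemma quot_scalerDr : right_distributive quot_scale +%R.
Proof.
move=> a; elim/quotW => u; elim/quotW => v.
by rewrite -quot_piD -!pi_scale -quot_piD scalerDr.
Qed.

Lemma quot_scalerDl v : {morph quot_scale^~ v : a b / a + b >-> a + b}.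
Proof.
by elim/quotW: v => v a b; rewrite -!pi_scale -quot_piD scalerDl.
Qed.

End QuotScale.

(* The lift [tlift f] is only meaningful for bilinear f. *)
Record tensor_product (K : fieldType) (A D : lmodType K) := TensorProduct {
  tensor_sort : lmodType K;
  tens_of : A -> D -> tensor_sort;
  tlift_of : forall V : lmodType K, (A -> D -> V) -> tensor_sort -> V;
  tens_of_bilinear : bilinear_for *:%R *:%R tens_of;
  tens_of_ind : forall P : tensor_sort -> Prop,
    P 0 -> (forall a d t, P t -> P (tens_of a d + t)) -> forall t, P t;
  tlift_of_linear : forall (V : lmodType K) (f : A -> D -> V),
    bilinear_for *:%R *:%R f -> linear (tlift_of f);
  tlift_of_tens : forall (V : lmodType K) (f : A -> D -> V),
    bilinear_for *:%R *:%R f -> forall a d, tlift_of f (tens_of a d) = f a d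
}.

Module TensorConstruction.
Section Tensor.
Variables (K : fieldType) (A D : lmodType K).
Local Notation free := {malg K[(A * D)%type]}.
Local Notation "<| a , d |>" := (<< (a, d) >> : free).

(** The subspace of bilinearity relations in the free vector space on A x D. *)
Inductive tens_rel : free -> Prop :=
| tens_rel0 : tens_rel 0
| tens_rel_lin c u v : tens_rel u -> tens_rel v -> tens_rel (c *: u + v)
| tens_rel_l c a a' d :
    tens_rel (<| c *: a + a', d |> - c *: <| a, d |> - <| a', d |>)
| tens_rel_r c a d d' :
    tens_rel (<| a, c *: d + d' |> - c *: <| a, d |> - <| a, d' |>).

Definition tens_sub : {pred free} := fun u => `[< tens_rel u >].

Fact tens_sub_closed : zmod_closed tens_sub.
Proof.
split; first exact/asboolP/tens_rel0.
move=> u v /asboolP ru /asboolP rv; apply/asboolP.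
by rewrite addrC -scaleN1r; exact: tens_rel_lin.
Qed.
HB.instance Definition _ := GRing.isZmodClosed.Build free tens_sub
  tens_sub_closed.
Definition tens_submod : zmodClosed free := tens_sub.

Fact tens_subZ c (u : free) : u \in tens_submod -> c *: u \in tens_submod.
Proof.
move=> /asboolP ru; apply/asboolP.
by rewrite -[_ *: _]addr0; apply: tens_rel_lin => //; exact: tens_rel0.
Qed.

Definition tensor : Type := {ideal_quot tens_submod}.
HB.instance Definition _ := GRing.Zmodule.on tensor.
HB.instance Definition _ := GRing.Zmodule_isLmodule.Build K tensor
  (quot_scalerA tens_subZ) (quot_scale1r tens_subZ)
  (quot_scalerDr tens_subZ) (quot_scalerDl tens_subZ).

Definition tens_pi : free -> tensor :=
  \pi_({ideal_quot tens_submod}).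
Definition tens (a : A) (d : D) : tensor := tens_pi <| a, d |>.

(** The linear map induced on the tensor product by a bilinear map [f]
    (see [tlift_tens]). *)
Definition tlift (V : lmodType K) (f : A -> D -> V) (t : tensor) : V :=
  let u : free := repr (t : {ideal_quot tens_submod}) in
  \sum_(k <- msupp u) u@_k *: f k.1 k.2.

Local Notation pit := tens_pi.

Let tens_piW (P : tensor -> Prop) : (forall u, P (pit u)) -> forall t, P t.
Proof. move=> Ppi t; rewrite -[t]reprK; exact: Ppi. Qed.
Let pitD u v : pit (u + v) = pit u + pit v.
Proof. exact: quot_piD. Qed.
Let pitZ c u : pit (c *: u) = c *: pit u.
Proof. exact: (pi_scale tens_subZ). Qed.
Let pitN u : pit (- u) = - pit u.
Proof. exact: Quotient.pi_opp. Qed.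
Let pit0 u : tens_rel u -> pit u = 0.
Proof.
move=> ru; have -> : (0 : tensor) = pit 0 by rewrite -(scale0r u) pitZ scale0r.
by  apply/eqP; rewrite -Quotient.idealrBE subr0; apply/asboolP.
Qed.

Lemma tens_bilinear : bilinear_for *:%R *:%R tens.
Proof.
split=> [d c a a'|a c d d']; apply/eqP; rewrite -subr_eq0 opprD addrA /tens /=.
  by rewrite -!pitZ -!pitN -!pitD; apply/eqP/pit0/tens_rel_l.
by rewrite -!pitZ -!pitN -!pitD; apply/eqP/pit0/tens_rel_r.
Qed.

Section Lift.
Variables (V : lmodType K) (f : A -> D -> V).
Hypothesis fB : bilinear_for *:%R *:%R f.

Let lift (u : free) : V := \sum_(k <- msupp u) u@_k *: f k.1 k.2.

Let liftEw (d : {fset (A * D)%type}) u : (msupp u `<=` d)%fset ->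
  lift u = \sum_(k <- d) u@_k *: f k.1 k.2.
Proof.
move=> le; rewrite /lift (big_fset_incl _ le) //= => x xd /mcoeff_outdom ->.
by rewrite scale0r.
Qed.

Let lift_lin c u v : lift (c *: u + v) = c *: lift u + lift v.
Proof.
pose E := (msupp u `|` msupp v `|` msupp (c *: u + v))%fset.
rewrite !(@liftEw E) ?scaler_sumr -?big_split /=; last first.
1-3: by apply/fsubsetP => k kin; rewrite !inE kin ?orbT.
apply: eq_bigr => k _.
by rewrite mcoeffD mcoeffZ scalerDl scalerA.
Qed.

Let liftU a d : lift <| a, d |> = f a d.
Proof.
by rewrite (liftEw msuppU_le) big_seq_fset1 mcoeffUU scale1r.
Qed.

Let lift0 : lift 0 = 0.
Proof. by rewrite /lift msupp0 big_seq_fset0. Qed.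

Let liftD u v : lift (u + v) = lift u + lift v.
Proof. by rewrite -[u in LHS]scale1r lift_lin scale1r. Qed.
Let liftZ c u : lift (c *: u) = c *: lift u.
Proof. by rewrite -[X in lift X]addr0 lift_lin lift0 addr0. Qed.
Let liftN u : lift (- u) = - lift u.
Proof. by rewrite -[in LHS]scaleN1r liftZ scaleN1r. Qed.

Let lift_rel u : tens_rel u -> lift u = 0.
Proof.
elim=> [//|c u' v _ u0 _ v0|c a a' d|c a d d'].
- by rewrite lift_lin u0 v0 scaler0 addr0.
- rewrite !liftD !liftN liftZ !liftU (fB.1 d c a a') /=.
  by rewrite -addrA -opprD subrr.
- rewrite !liftD !liftN liftZ !liftU (fB.2 a c d d') /=.
  by rewrite -addrA -opprD subrr.
Qed.

Let tlift_pi u : tlift f (pit u) = lift u.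
Proof.
rewrite /tlift -/(lift _); set w := repr _.
have /asboolP/lift_rel : w - u \in tens_submod.
  by rewrite Quotient.idealrBE reprK.
by rewrite liftD liftN => /eqP; rewrite subr_eq0 => /eqP.
Qed.

Lemma tlift_linear : linear (tlift f).
Proof.
move=> c; elim/tens_piW => u; elim/tens_piW => v.
by rewrite -(pitZ c u) -(pitD _ v) !tlift_pi lift_lin.
Qed.

Lemma tlift_tens a d : tlift f (tens a d) = f a d.
Proof. by rewrite /tens tlift_pi liftU. Qed.

End Lift.

Lemma tens_ind (P : tensor -> Prop) :
  P 0 -> (forall a d t, P t -> P (tens a d + t)) -> forall t, P t.
Proof.
move=> P0 PD; elim/tens_piW => u; rewrite [u]monalgE.
elim: (msupp u : seq _) => [|[a d] s IH].
  by rewrite big_nil pit0 //; exact: tens_rel0.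
rewrite big_cons pitD.
suff -> : pit << u@_(a, d) *g (a, d) >> = tens (u@_(a, d) *: a) d by exact: PD.
have := tens_bilinear.1 d (u@_(a, d)) a 0.
have -> : tens 0 d = 0.
  by have := tens_bilinear.1 d (-1) 0 0; rewrite /= scaler0 addr0 scaleN1r addNr.
rewrite !addr0 => ->; rewrite /= -pitZ; congr tens_pi.
by apply/malgP => k; rewrite mcoeffZ !mcoeffU mulr_natr.
Qed.

End Tensor.

Arguments tens {K A D}.

Definition tensor_lmod (K : fieldType) (A D : lmodType K) : lmodType K :=
  tensor A D.

End TensorConstruction.

(* Opaque: only the characterisation by [tensor_product] is usable. *)
Fact tensor_exists (K : fieldType) (A D : lmodType K) : tensor_product A D.
Proof.
apply: (@TensorProduct K A D (TensorConstruction.tensor_lmod A D)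
  (@TensorConstruction.tens K A D) (@TensorConstruction.tlift K A D)).
- exact: TensorConstruction.tens_bilinear.
- exact: TensorConstruction.tens_ind.
- exact: TensorConstruction.tlift_linear.
- exact: TensorConstruction.tlift_tens.
Qed.

Section Tensor.
Variables (K : fieldType) (A D : lmodType K).

Definition tensor : lmodType K := tensor_sort (tensor_exists A D).
Definition tens : A -> D -> tensor := @tens_of _ _ _ (tensor_exists A D).
Definition tlift (V : lmodType K) (f : A -> D -> V) : tensor -> V :=
  @tlift_of _ _ _ (tensor_exists A D) V f.

Lemma tens_bilinear : bilinear_for *:%R *:%R tens.
Proof. exact: tens_of_bilinear. Qed.

Lemma tens_ind (P : tensor -> Prop) :
  P 0 -> (forall a d t, P t -> P (tens a d + t)) -> forall t, P t.
Proof. exact: tens_of_ind. Qed.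

Lemma tlift_linear (V : lmodType K) (f : A -> D -> V) :
  bilinear_for *:%R *:%R f -> linear (tlift f).
Proof. exact: tlift_of_linear. Qed.

Lemma tlift_tens (V : lmodType K) (f : A -> D -> V) :
  bilinear_for *:%R *:%R f -> forall a d, tlift f (tens a d) = f a d.
Proof. exact: tlift_of_tens. Qed.

End Tensor.

Arguments tens {K A D}.
Arguments tlift {K A D V}.

Section TensorMaps.
Variables (K : fieldType) (D : lmodType K).

Definition tmap (A A' D' : lmodType K) (f : A -> A') (g : D -> D') :
  tensor A D -> tensor A' D' := tlift (fun a d => tens (f a) (g d)).

Definition tact (A : comAlgType K) (a : A) : tensor A D -> tensor A D :=
  tmap (fun b => a * b) id.

(* The composite of [xi (x) id] with the identification of K (x) D with D. *)
Definition tcontract (A : lmodType K) (xi : A -> K) : tensor A D -> D :=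
  tlift (fun a d => xi a *: d).

End TensorMaps.

Record dialg_ops (D : Type) := DialgOps {
  ldot : D -> D -> D;
  rdot : D -> D -> D
}.

Declare Scope dialg_scope.
Local Open Scope dialg_scope.
Notation "x '⊣[' s ] y" := (ldot s x y)
  (at level 40, s at level 200, left associativity) : dialg_scope.
Notation "x '⊢[' s ] y" := (rdot s x y)
  (at level 40, s at level 200, left associativity) : dialg_scope.

Record is_dialgebra (K : fieldType) (D : lmodType K) (s : dialg_ops D) : Prop :=
  IsDialgebra {
  ldot_bilinear : bilinear_for *:%R *:%R (ldot s);
  rdot_bilinear : bilinear_for *:%R *:%R (rdot s);
  dialg_ll : forall x y z, x ⊣[s] (y ⊣[s] z) = (x ⊣[s] y) ⊣[s] z;
  dialg_lr : forall x y z, (x ⊣[s] y) ⊣[s] z = x ⊣[s] (y ⊢[s] z);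
  dialg_rl : forall x y z, (x ⊢[s] y) ⊣[s] z = x ⊢[s] (y ⊣[s] z);
  dialg_lr' : forall x y z, (x ⊣[s] y) ⊢[s] z = x ⊢[s] (y ⊢[s] z);
  dialg_rr : forall x y z, x ⊢[s] (y ⊢[s] z) = (x ⊢[s] y) ⊢[s] z
}.

Definition dialg_morphism (D D' : Type) (s : dialg_ops D) (s' : dialg_ops D')
    (f : D -> D') : Prop :=
  {morph f : x y / x ⊣[s] y >-> x ⊣[s'] y} /\
  {morph f : x y / x ⊢[s] y >-> x ⊢[s'] y}.

Inductive bintree := Leaf | Graft of bintree & bintree.

Fixpoint vertices t : nat :=
  if t is Graft l r then (vertices l + vertices r).+1%N else 0%N.

(* Leaves are numbered from 0, from left to right; the left subtree of
   [Graft l r] has the leaves 0, ..., vertices l. *)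
Fixpoint del_leaf t i :=
  if t is Graft l r then
    if (i <= vertices l)%N
    then if l is Leaf then r else Graft (del_leaf l i) r
    else if r is Leaf then l else Graft l (del_leaf r (i - (vertices l).+1)%N)
  else Leaf.

(* A leaf is oriented like \ when it is the left child of its vertex, and
   like / when it is the right child. *)
Fixpoint backslash_leaf t i :=
  if t is Graft l r then
    if (i <= vertices l)%N
    then if l is Leaf then true else backslash_leaf l i
    else if r is Leaf then false else backslash_leaf r (i - (vertices l).+1)%N
  else false.

Lemma vertices_del_leaf t i :
  (i <= vertices t)%N -> vertices (del_leaf t i) = (vertices t).-1.
Proof.
elim: t i => [|l IHl r IHr] i //= ile; case: leqP => [il|li].
  case: l IHl il {ile} => [//|l1 l2] IHl il.
  by rewrite [LHS]/= IHl.
case: r IHr ile => [|r1 r2] IHr ile; first by rewrite addn0.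
rewrite [LHS]/= IHr; first by rewrite /= addnS.
by rewrite leq_subLR addSn -ltnS.
Qed.

Definition Y (n : nat) := {t : bintree | vertices t == n}.

Fact face_subproof n (y : Y n.+1) (i : 'I_n.+2) :
  vertices (del_leaf (sval y) i) == n.
Proof.
by case: y => t /= /eqP e; rewrite vertices_del_leaf e //= -ltnS.
Qed.
Definition face n (y : Y n.+1) (i : 'I_n.+2) : Y n :=
  exist _ (del_leaf (sval y) i) (face_subproof y i).

Definition tree21 : Y 2 := exist _ (Graft Leaf (Graft Leaf Leaf)) isT.
Definition tree12 : Y 2 := exist _ (Graft (Graft Leaf Leaf) Leaf) isT.

Section Cohomology.
Variables (K : fieldType) (D : lmodType K) (s : dialg_ops D).

(* The n-cochains are the functions below that are multilinear. *)
Definition cochain (n : nat) := Y n -> {ffun 'I_n -> D} -> D.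

Definition upd n (a : {ffun 'I_n -> D}) (i : 'I_n) (x : D) : {ffun 'I_n -> D} :=
  [ffun j => if j == i then x else a j].

Definition multilinear n (f : cochain n) : Prop :=
  forall y a i, linear (fun x => f y (upd a i x)).

(* The product attached to the i-th leaf of y, true standing for the left
   product and false for the right product. *)
Definition leaf_is_left n (y : Y n.+1) (i : 'I_n.+2) : bool :=
  if i == ord0 then (if sval y is Graft Leaf _ then true else false)
  else if i == ord_max then (if sval y is Graft _ Leaf then false else true)
  else backslash_leaf (sval y) i.

Definition leaf_op n (y : Y n.+1) (i : 'I_n.+2) (u v : D) : D :=
  if leaf_is_left y i then u ⊣[s] v else u ⊢[s] v.

(* The arguments a_1, ..., a_(n+1) are indexed here by 0, ..., n. *)
Definition coface n (f : cochain n) (i : 'I_n.+2) : cochain n.+1 :=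
  fun y a =>
  if i == ord0 then
    leaf_op y i (a ord0) (f (face y i) [ffun j => a (lift ord0 j)])
  else if i == ord_max then
    leaf_op y i (f (face y i) [ffun j => a (widen_ord (leqnSn n) j)]) (a ord_max)
  else
    f (face y i) [ffun j : 'I_n =>
      if (j.+1 < i)%N then a (widen_ord (leqnSn n) j)
      else if j.+1 == i :> nat
      then leaf_op y i (a (widen_ord (leqnSn n) j)) (a (lift ord0 j))
      else a (lift ord0 j)].

Definition coboundary n (f : cochain n) : cochain n.+1 :=
  fun y a => \sum_(i < n.+2) (-1) ^+ i *: coface f i y a.

Definition cocycle n (f : cochain n) : Prop :=
  multilinear f /\ forall y a, coboundary f y a = 0.

(* The elements of HY^(n+1)(D, D) are the cosets [HYclass f] of cocycles f. *)
Definition HYclass n (f g : cochain n.+1) : Prop :=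
  cocycle g /\
  exists2 h : cochain n, multilinear h &
    forall y a, g y a - f y a = coboundary h y a.

Definition pair2 (x1 x2 : D) : {ffun 'I_2 -> D} :=
  [ffun i => if i == ord0 then x1 else x2].

End Cohomology.

Section Deformations.
Variables (K : fieldType) (D : lmodType K) (s : dialg_ops D).

Definition tens_aug (A : comAlgType K) (eps : A -> K) : tensor A D -> D :=
  tcontract eps.

Record is_deformation (A : comAlgType K) (eps : A -> K)
    (lam : dialg_ops (tensor A D)) : Prop := IsDeformation {
  deformation_dialgebra : is_dialgebra lam;
  deformation_ldotZl : forall a l1 l2, tact a l1 ⊣[lam] l2 = tact a (l1 ⊣[lam] l2);
  deformation_ldotZr : forall a l1 l2, l1 ⊣[lam] tact a l2 = tact a (l1 ⊣[lam] l2);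
  deformation_rdotZl : forall a l1 l2, tact a l1 ⊢[lam] l2 = tact a (l1 ⊢[lam] l2);
  deformation_rdotZr : forall a l1 l2, l1 ⊢[lam] tact a l2 = tact a (l1 ⊢[lam] l2);
  deformation_aug : dialg_morphism lam s (tens_aug eps)
}.

Definition deformation_equiv (A : comAlgType K) (eps : A -> K)
    (lam lam' : dialg_ops (tensor A D)) : Prop :=
  exists f : tensor A D -> tensor A D,
    [/\ linear f /\ (forall a l, f (tact a l) = tact a (f l)),
        bijective f,
        dialg_morphism lam lam' f &
        forall l, tens_aug eps (f l) = tens_aug eps l].

Section Pushout.
Variables (A A' : comAlgType K) (phi : A -> A') (lam : dialg_ops (tensor A D)).

Definition base_change : tensor A D -> tensor A' D := tmap phi id.

(* A' (x) D is identified with A' (x)_A (A (x) D), the element a' (x)_A l being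
   [tact a' (base_change l)]; in particular [tens a' x] is a' (x)_A (1 (x) x).
   The general formula for the product is [pushout_prodE]. *)
Definition pushout_prod (m : tensor A D -> tensor A D -> tensor A D)
    (l1 l2 : tensor A' D) : tensor A' D :=
  tlift (fun a1 x1 =>
    tlift (fun a2 x2 =>
      tact (a1 * a2) (base_change (m (tens 1 x1) (tens 1 x2)))) l2) l1.

Definition pushout : dialg_ops (tensor A' D) :=
  DialgOps (pushout_prod (ldot lam)) (pushout_prod (rdot lam)).

End Pushout.

End Deformations.

Section PushoutFormula.
Variables (K : fieldType) (D : lmodType K) (A A' : comAlgType K).
Variable phi : {lrmorphism A -> A'}.

Lemma tmap_bilinear (U U' : lmodType K) (f : {linear U -> U'}) :
  bilinear_for *:%R *:%R (fun a (d : D) => tens (f a) d).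
Proof.
split=> [d c a a'|a c d d'] /=; last exact: (tens_bilinear U' D).2.
by rewrite linearP; exact: (tens_bilinear U' D).1.
Qed.

Lemma tact_bilinear (R : comAlgType K) (a : R) :
  bilinear_for *:%R *:%R (fun b (d : D) => tens (a * b) d).
Proof.
split=> [d c b b'|b c d d'] /=; last exact: (tens_bilinear R D).2.
by rewrite mulrDr -scalerAr; exact: (tens_bilinear R D).1.
Qed.

Lemma tact_tens (R : comAlgType K) (a b : R) (d : D) :
  tact a (tens b d) = tens (a * b) d.
Proof. exact: (tlift_tens (tact_bilinear a)). Qed.

Lemma tact_linear (R : comAlgType K) (a : R) : linear (@tact K D R a).
Proof. exact: (tlift_linear (tact_bilinear a)). Qed.

Lemma base_change_linear : linear (@base_change K D A A' phi).
Proof. exact: (tlift_linear (tmap_bilinear phi)). Qed.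

Lemma base_change_tens a (d : D) : base_change phi (tens a d) = tens (phi a) d.
Proof. exact: (tlift_tens (tmap_bilinear phi)). Qed.

Let lin0 (U V : lmodType K) (f : U -> V) : linear f -> f 0 = 0.
Proof.
by move=> fL; have := fL (-1) 0 0; rewrite scaleN1r oppr0 addr0 scaleN1r addNr.
Qed.
Let linD (U V : lmodType K) (f : U -> V) : linear f ->
  forall x y, f (x + y) = f x + f y.
Proof. by move=> fL x y; have := fL 1 x y; rewrite !scale1r. Qed.

Let tact0 (R : comAlgType K) (a : R) : tact a (0 : tensor R D) = 0.
Proof. exact: lin0 (tact_linear a). Qed.
Let tactD (R : comAlgType K) (a : R) (l l' : tensor R D) :
  tact a (l + l') = tact a l + tact a l'.
Proof. exact: linD (tact_linear a) _ _. Qed.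
Let bc0 : base_change phi (0 : tensor A D) = 0.
Proof. exact: lin0 base_change_linear. Qed.
Let bcD (l l' : tensor A D) :
  base_change phi (l + l') = base_change phi l + base_change phi l'.
Proof. exact: linD base_change_linear _ _. Qed.

Let tactM (R : comAlgType K) (a b : R) (l : tensor R D) :
  tact a (tact b l) = tact (a * b) l.
Proof.
elim/tens_ind: l => [|c d l IH]; first by rewrite !tact0.
by rewrite !tactD IH !tact_tens mulrA.
Qed.

Let tactDl (R : comAlgType K) c (a b : R) (l : tensor R D) :
  tact (c *: a + b) l = c *: tact a l + tact b l.
Proof.
elim/tens_ind: l => [|e d l IH]; first by rewrite !tact0 scaler0 addr0.
rewrite !tactD IH !tact_tens mulrDl -scalerAl.
by rewrite ((tens_bilinear R D).1 d c) /= scalerDr addrACA.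
Qed.

Let base_change_act a (l : tensor A D) :
  base_change phi (tact a l) = tact (phi a) (base_change phi l).
Proof.
elim/tens_ind: l => [|c d l IH]; first by rewrite tact0 bc0 tact0.
by rewrite tactD !bcD tactD IH !(tact_tens, base_change_tens) rmorphM.
Qed.

Lemma pushout_prodE (m : tensor A D -> tensor A D -> tensor A D) :
  bilinear_for *:%R *:%R m ->
  (forall a l1 l2, m (tact a l1) l2 = tact a (m l1 l2)) ->
  (forall a l1 l2, m l1 (tact a l2) = tact a (m l1 l2)) ->
  forall a1 a2 l1 l2,
  pushout_prod phi m (tact a1 (base_change phi l1))
                     (tact a2 (base_change phi l2)) =
  tact (a1 * a2) (base_change phi (m l1 l2)).
Proof.
move=> mB mZl mZr a1 a2 l1 l2.
have tensE (a : A) (d : D) : tens a d = tact a (tens 1 d).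
  by rewrite tact_tens mulr1.
pose g b1 (x1 : D) b2 (x2 : D) :=
  tact (b1 * b2) (base_change phi (m (tens 1 x1) (tens 1 x2))).
have gB b1 x1 : bilinear_for *:%R *:%R (g b1 x1).
  split=> [x2 c b b'|b c x x']; rewrite /g /=.
    by rewrite mulrDr -scalerAr tactDl.
  by rewrite ((tens_bilinear A D).2 1 c) (mB.2 _ c) base_change_linear tact_linear.
have g0 b1 x1 : tlift (g b1 x1) 0 = 0 by exact: lin0 (tlift_linear (gB b1 x1)).
have gD b1 x1 t t' :
    tlift (g b1 x1) (t + t') = tlift (g b1 x1) t + tlift (g b1 x1) t'.
  exact: linD (tlift_linear (gB b1 x1)) _ _.
have gE b1 x1 b2 x2 : tlift (g b1 x1) (tens b2 x2) = g b1 x1 b2 x2.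
  exact: tlift_tens (gB b1 x1) _ _.
pose t2 := tact a2 (base_change phi l2).
have gB' : bilinear_for *:%R *:%R (fun b1 x1 => tlift (g b1 x1) t2).
  split=> [x c b b'|b c x x'] /=;
    elim/tens_ind: t2 => [|b2 x2 t IH]; rewrite ?g0 ?scaler0 ?addr0 //;
    rewrite !gD IH !gE /g.
    by rewrite mulrDl -scalerAl tactDl scalerDr addrACA.
  rewrite ((tens_bilinear A D).2 1 c) (mB.1 _ c) base_change_linear.
  by rewrite tact_linear scalerDr addrACA.
have p0 : pushout_prod phi m 0 t2 = 0 by exact: lin0 (tlift_linear gB').
have pD l l' :
    pushout_prod phi m (l + l') t2 = pushout_prod phi m l t2 + pushout_prod phi m l' t2.
  exact: linD (tlift_linear gB') _ _.
have pE b1 x1 : pushout_prod phi m (tens b1 x1) t2 = tlift (g b1 x1) t2.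
  exact: tlift_tens gB' _ _.
have m0l l : m 0 l = 0 by exact: lin0 (mB.1 l).
have m0r l : m l 0 = 0 by exact: lin0 (mB.2 l).
have mDl l l' l'' : m (l + l') l'' = m l l'' + m l' l''.
  exact: linD (mB.1 l'') _ _.
have mDr l l' l'' : m l'' (l + l') = m l'' l + m l'' l'.
  exact: linD (mB.2 l'') _ _.
rewrite -/t2; elim/tens_ind: l1 => [|b1 x1 l1 IH].
  by rewrite bc0 tact0 p0 m0l bc0 tact0.
rewrite bcD tactD pD IH mDl bcD tactD; congr (_ + _).
rewrite base_change_tens tact_tens pE /t2.
elim/tens_ind: {t2 gB' p0 pD pE IH} l2 => [|b2 x2 l2 IH].
  by rewrite bc0 tact0 g0 m0r bc0 tact0.
rewrite bcD tactD gD IH mDr bcD tactD; congr (_ + _).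
rewrite base_change_tens tact_tens gE /g.
rewrite (tensE b1) (tensE b2) mZl mZr !base_change_act !tactM.
by congr tact; rewrite mulrACA !mulrA.
Qed.

End PushoutFormula.

Definition finite_dimensional (K : fieldType) (V : lmodType K) : Prop :=
  exists n (e : 'I_n -> V),
    forall v, exists c : 'I_n -> K, v = \sum_i c i *: e i.

(* [idealr_closed] says that a subset is a proper ideal. *)
Definition maximal_ideal (A : comNzRingType) (J : {pred A}) : Prop :=
  idealr_closed J /\
  forall J' : {pred A}, idealr_closed J' -> {subset J <= J'} -> J' =i J.

Definition local_with (A : comNzRingType) (m : {pred A}) : Prop :=
  forall J : {pred A}, maximal_ideal J <-> J =i m.

Section Jet.
Variables (K : fieldType) (A : comAlgType K) (eps : {lrmorphism A -> K^o}).

Definition aug_ideal : {pred A} := fun a => eps a == 0.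

(* The ideal m^2, generated by the products of two elements of m. *)
Definition aug_sq : {pred A} := fun a =>
  `[< exists2 s : seq (A * A),
        {in s, forall xy, xy.1 \in aug_ideal /\ xy.2 \in aug_ideal} &
        a = \sum_(xy <- s) xy.1 * xy.2 >].

Fact aug_sq_idealr_closed : idealr_closed aug_sq.
Proof.
split.
- by apply/asboolP; exists [::] => //; rewrite big_nil.
- apply/asboolP => -[t tm /(congr1 eps)/eqP].
  rewrite rmorph1 rmorph_sum big_seq big1 ?oner_eq0 // => -[x y] /tm[/= xm _].
  by rewrite rmorphM /= (eqP xm) mul0r.
- move=> a _ _ /asboolP[t tm ->] /asboolP[t' tm' ->]; apply/asboolP.
  exists ([seq (a * xy.1, xy.2) | xy <- t] ++ t').
    move=> xy; rewrite mem_cat => /orP[/mapP[[x y] /tm[/= xm ym] ->]|/tm' //].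
    split=> //=; apply/eqP; rewrite rmorphM /= (eqP xm); exact: mulr0.
  rewrite big_cat big_map mulr_sumr /=.
  by congr (_ + _); apply: eq_bigr => xy _; rewrite mulrA.
Qed.
HB.instance Definition _ := isIdealr.Build A aug_sq aug_sq_idealr_closed.
Definition aug_sq_ideal : idealr A := aug_sq.

Fact aug_sqZ (c : K) (a : A) : a \in aug_sq_ideal -> c *: a \in aug_sq_ideal.
Proof. by move=> am; rewrite -mulr_algl; exact: idealMr. Qed.

(** The algebra A / m^2. *)
Definition jet : Type := {ideal_quot aug_sq_ideal}.
HB.instance Definition _ := GRing.ComNzRing.on jet.
HB.instance Definition _ := GRing.Zmodule_isLmodule.Build K jet
  (quot_scalerA aug_sqZ) (quot_scale1r aug_sqZ)
  (quot_scalerDr aug_sqZ) (quot_scalerDl aug_sqZ).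

Definition jet_pi : A -> jet :=
  \pi_({ideal_quot aug_sq_ideal}).
Definition jet_repr : jet -> A :=
  fun x => repr (x : {ideal_quot aug_sq_ideal}).

Lemma jet_reprK : cancel jet_repr jet_pi.
Proof. exact: reprK. Qed.
Lemma jet_piZ c : {morph jet_pi : x / c *: x}.
Proof. exact: (pi_scale aug_sqZ). Qed.
Lemma jet_piM : {morph jet_pi : x y / x * y}.
Proof. exact: Quotient.pi_mul. Qed.
Lemma jet_piD : {morph jet_pi : x y / x + y}.
Proof. exact: quot_piD. Qed.
Lemma jet_pi1 : jet_pi 1 = 1.
Proof.
rewrite -[LHS]mulr1; move: (jet_reprK 1) => e; rewrite -[in X in _ * X]e.
by rewrite -jet_piM mul1r e.
Qed.
Lemma jet_pi_eq0 a : (jet_pi a == 0) = (a \in aug_sq).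
Proof.
have -> : 0 = jet_pi 0 by rewrite -[X in jet_pi X](scale0r (0 : A)) jet_piZ scale0r.
by rewrite -[in RHS](subr0 a) -/(a - 0 \in aug_sq_ideal) Quotient.idealrBE.
Qed.

Fact jet_scalerAl (a : K) (u v : jet) : a *: (u * v) = (a *: u) * v.
Proof.
by rewrite -[u]jet_reprK -[v]jet_reprK -!(jet_piM, jet_piZ) scalerAl.
Qed.
HB.instance Definition _ := GRing.Lmodule_isLalgebra.Build K jet jet_scalerAl.
HB.instance Definition _ := GRing.Lalgebra_isComAlgebra.Build K jet.

(* A linear form on m / m^2, extended by 0 on 1 to A / m^2, is given by its
   composite h : A -> K with the projection, a derivation (see [tangentE]). *)
Definition tangent (h : A -> K) (x : jet) : K := h (jet_repr x).

Definition derivation (h : A -> K) : Prop :=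
  forall a b, h (a * b) = eps a * h b + h a * eps b.

Lemma tangentE (h : {scalar A}) a : derivation h -> tangent h (jet_pi a) = h a.
Proof.
move=> hD; apply/eqP; rewrite -subr_eq0 -linearB.
have /asboolP[t tm ->] : jet_repr (jet_pi a) - a \in aug_sq_ideal.
  by rewrite Quotient.idealrBE reprK.
rewrite linear_sum big_seq big1 // => -[x y] /tm[/= /eqP xm /eqP ym].
by rewrite hD xm ym mul0r mulr0 addr0.
Qed.

Section Differential.
Variables (D : lmodType K).

Definition alpha (R : comAlgType K) (kappa : dialg_ops (tensor R D))
    (xi : R -> K) : cochain D 2%N :=
  fun y a =>
  let l1 := tens 1 (a ord0) in let l2 := tens 1 (a ord_max) in
  tcontract xi
    (if sval y is Graft Leaf _ (* y = [21] *)
     then l1 ⊣[kappa] l2 else l1 ⊢[kappa] l2).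

(* The class d lam (h) in HY^2(D, D), as a set of cocycles. *)
Definition differential (s : dialg_ops D) (lam : dialg_ops (tensor A D))
    (h : A -> K) : cochain D 2%N -> Prop :=
  HYclass s (alpha (pushout jet_pi lam) (tangent h)).

End Differential.

Section Extension.
Variables (B : comAlgType K) (i : {linear K^o -> B}) (p : {lrmorphism B -> A}).

Record is_extension : Prop := IsExtension {
  ext_inj : injective i;
  ext_surj : forall a, exists b, p b = a;
  ext_exact : forall b, p b = 0 <-> exists k, b = i k;
  ext_module : forall b k, b * i k = i (eps (p b) * k)
}.

Record is_harrison_cocycle2 (f : A -> A -> K) : Prop := IsHarrisonCocycle2 {
  harrison_bilinear : bilinear_for *%R *%R f;
  harrison_sym : forall a b, f a b = f b a;
  harrison_cocycle : forall a b c,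
    eps a * f b c - f (a * b) c + f a (b * c) - f a b * eps c = 0
}.

(* The class of the extension is the class of f. *)
Definition extension_class (f : A -> A -> K) : Prop :=
  exists2 sec : {linear A -> B}, cancel sec p &
    forall a b, i (f a b) = sec a * sec b - sec (a * b).

Definition is_ext_automorphism (r : B -> B) : Prop :=
  [/\ bijective r, forall k, r (i k) = i k & forall b, p (r b) = p b].

Definition ext_aug (b : B) : K := eps (p b).

Section Lifts.
Variables (D : lmodType K) (s : dialg_ops D).

(* The composite of the identification of D with K (x) D and [i (x) id]. *)
Definition ext_incl (x : D) : tensor B D := tens (i 1) x.

Definition lifts (lam : dialg_ops (tensor A D)) (mu : dialg_ops (tensor B D)) :=
  is_deformation s ext_aug mu /\ pushout p mu = lam.

Definition difference (mu1 mu : dialg_ops (tensor B D)) (psi : cochain D 2%N) :=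
  let E := tens_aug ext_aug in
  forall l1 l2,
    l1 ⊣[mu1] l2 - l1 ⊣[mu] l2 = ext_incl (psi tree21 (pair2 (E l1) (E l2))) /\
    l1 ⊢[mu1] l2 - l1 ⊢[mu] l2 = ext_incl (psi tree12 (pair2 (E l1) (E l2))).

(* The operation of HY^2(D, D) on the equivalence classes of the lifts of lam:
   the element c of HY^2(D, D) sends the class of mu to the class of mu'. *)
Definition HY2_sends (lam : dialg_ops (tensor A D)) (c : cochain D 2%N -> Prop)
    (mu mu' : dialg_ops (tensor B D)) : Prop :=
  exists psi mu1, [/\ c psi, lifts lam mu1, difference mu1 mu psi &
                      deformation_equiv ext_aug mu1 mu'].

End Lifts.

End Extension.

End Jet.

(* Main.v *)
From HB Require Import structures.
Require Import Defs.
From mathcomp Require Import all_boot all_algebra.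
From mathcomp Require Import sesquilinear boolp.

Set Implicit Arguments.
Unset Strict Implicit.
Unset Printing Implicit Defensive.

Import GRing.Theory.
Local Open Scope ring_scope.

(** An automorphism [r] of the extension is [id + i h p], so on [B (x) D] it is
    the identity plus [I (h (x) id) (p (x) id)], where [I] includes [D] by [i].
    The push-out [r_* mu] has the structure constants of [mu] changed by [r]:
    on the elements [1 (x) x] its products differ from those of [mu] by
    [I] of the [h]-component of the product in [p_* mu = lam]. Both
    products are [B]-bilinear, and [B] acts on the image of [I] through the
    augmentation, so this determines the difference everywhere: it is the
    cochain [alpha lam h] ([pushout_prod_difference], [difference_automorphism]).

    It remains to see that this cochain represents [d lam (h)]. The class
    [d lam (h)] is defined from the reduction of [lam] modulo the square of the
    maximal ideal, but a derivation vanishes on that square, so the reduction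
    gives the same cochain ([alpha_jet]). That it is a cocycle
    ([alpha_cocycle]) is the Leibniz rule: since [h] is a derivation,
    [h (x) id] is a derivation of the deformed products over the augmentation,
    up to the correction [alpha lam h] itself ([contract_prod]). Applying
    [h (x) id] to each of the five dialgebra axioms of [lam] gives the
    coboundary equation at the corresponding tree with three vertices
    ([variation_assoc]).

    Finally [r_* mu] is again a lift of [lam]: the push-out along a surjection
    inherits the identities of [mu] ([pushout_deformation]), and [p r = p]
    gives [p_* (r_* mu) = p_* mu] ([pushout_comp]). *)

Local Notation bilin f := (bilinear_for *:%R *:%R f).

(** * Linear and bilinear maps on tensor products *)

Section LinearFacts.
Variables (K : fieldType) (U V : lmodType K) (f : U -> V).
Hypothesis fL : linear f.

Lemma lin0 : f 0 = 0.
Proof. by have := fL (-1) 0 0; rewrite scaler0 addr0 scaleN1r addNr. Qed.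
Lemma linD : {morph f : x y / x + y}.
Proof. by move=> x y; have := fL 1 x y; rewrite !scale1r. Qed.
Lemma linZ c : {morph f : x / c *: x}.
Proof. by move=> x; have := fL c x 0; rewrite lin0 !addr0. Qed.

End LinearFacts.

Section BilinearFacts.
Variables (K : fieldType) (U U' V : lmodType K).

Lemma add_bilinear (f g : U -> U' -> V) :
  bilin f -> bilin g -> bilin (fun u u' => f u u' + g u u').
Proof.
move=> [fl fr] [gl gr]; split=> [v c u u'|u c v v'] /=.
  by rewrite fl gl /= scalerDr addrACA.
by rewrite fr gr /= scalerDr addrACA.
Qed.

Lemma comp_bilinear (X X' W : lmodType K) (f : U -> U' -> V) (g : V -> W)
    (k : X -> U) (k' : X' -> U') :
  bilin f -> linear g -> linear k -> linear k' ->
  bilin (fun x x' => g (f (k x) (k' x'))).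
Proof.
move=> [fl fr] gL kL k'L; split=> [v c u u'|u c v v'] /=.
  by rewrite kL fl gL.
by rewrite k'L fr gL.
Qed.

End BilinearFacts.

Section Tensors.
Variables (K : fieldType) (D : lmodType K).

Lemma tens_linear_ext (U W : lmodType K) (f g : tensor U D -> W) :
  linear f -> linear g -> (forall a d, f (tens a d) = g (tens a d)) -> f =1 g.
Proof.
move=> fL gL fg; elim/tens_ind => [|a d t IH]; first by rewrite !lin0.
by rewrite (linD fL) (linD gL) fg IH.
Qed.

Lemma tens_bilinear_ext (U U' W : lmodType K)
    (f g : tensor U D -> tensor U' D -> W) :
  bilin f -> bilin g ->
  (forall a d a' d', f (tens a d) (tens a' d') = g (tens a d) (tens a' d')) ->
  f =2 g.
Proof.
move=> [fl fr] [gl gr] fg l1 l2; move: l1.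
apply: tens_linear_ext (fl l2) (gl l2) _ => a d; move: l2.
exact: tens_linear_ext (fr _) (gr _) (fg a d).
Qed.

Section Contraction.
Variables (U : lmodType K) (xi : U -> K).
Hypothesis xiL : scalar xi.

Let contract_bilinear : bilin (fun a (d : D) => xi a *: d).
Proof.
split=> [d c a a'|a c d d'] /=; first by rewrite xiL scalerDl scalerA.
by rewrite scalerDr !scalerA mulrC.
Qed.

Lemma tcontract_linear : linear (@tcontract K D U xi).
Proof. exact: tlift_linear contract_bilinear. Qed.

Lemma tcontract_tens a (d : D) : tcontract xi (tens a d) = xi a *: d.
Proof. exact: (tlift_tens contract_bilinear). Qed.

End Contraction.

Lemma tact1 (A : comAlgType K) (l : tensor A D) : tact 1 l = l.
Proof.
apply: tens_linear_ext l; [exact: tact_linear | by [] | ].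
by move=> a d; rewrite tact_tens mul1r.
Qed.

Lemma tact_mul (A : comAlgType K) (a b : A) (l : tensor A D) :
  tact (a * b) l = tact a (tact b l).
Proof.
move: l; apply: tens_linear_ext => [||c d]; first exact: tact_linear.
  by move=> c u v; rewrite !tact_linear.
by rewrite !tact_tens mulrA.
Qed.

Lemma tens_act (A : comAlgType K) (a : A) (d : D) : tens a d = tact a (tens 1 d).
Proof. by rewrite tact_tens mulr1. Qed.

Section BaseChange.
Variables (A A' : comAlgType K) (phi : {lrmorphism A -> A'}).

Lemma tcontract_base_change (xi : A -> K) (xi' : A' -> K) (l : tensor A D) :
  scalar xi -> scalar xi' -> (forall a, xi' (phi a) = xi a) ->
  tcontract xi' (base_change phi l) = tcontract xi l.
Proof.
move=> xiL xi'L e; move: l.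
apply: tens_linear_ext => [||a d].
- by move=> c u v; rewrite base_change_linear tcontract_linear.
- exact: tcontract_linear.
- by rewrite base_change_tens !tcontract_tens ?e.
Qed.

Lemma base_change_comp (A'' : comAlgType K) (phi' : {lrmorphism A' -> A''})
    (l : tensor A D) :
  base_change phi' (base_change phi l) = base_change (phi' \o phi) l.
Proof.
move: l; apply: tens_linear_ext => [||a d].
- by move=> c u v; rewrite !base_change_linear.
- exact: base_change_linear.
- by rewrite !base_change_tens.
Qed.

Lemma base_change_surj :
  (forall a', exists a, phi a = a') ->
  forall l' : tensor A' D, exists l, base_change phi l = l'.
Proof.
move=> phi_surj; elim/tens_ind => [|a' d t [l <-]].
  by exists 0; exact: lin0 (base_change_linear _).
have [a <-] := phi_surj a'; exists (tens a d + l).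
by rewrite (linD (base_change_linear _)) base_change_tens.
Qed.

End BaseChange.

End Tensors.

(** * One product of a deformation, and its push-outs *)

Section DeformedProducts.
Variables (K : fieldType) (D : lmodType K).

(** What a deformation asks of one of its two products, apart from the
    dialgebra identities: every argument below treats the two products alike. *)
Record deforms (A : comAlgType K) (eps : A -> K)
    (m : tensor A D -> tensor A D -> tensor A D) (n : D -> D -> D) : Prop :=
  Deforms {
  deforms_bilinear : bilin m;
  deforms_actl : forall a l1 l2, m (tact a l1) l2 = tact a (m l1 l2);
  deforms_actr : forall a l1 l2, m l1 (tact a l2) = tact a (m l1 l2);
  deforms_aug : {morph tens_aug eps : l1 l2 / m l1 l2 >-> n l1 l2}
}.

Lemma deforms_ldot (s : dialg_ops D) (A : comAlgType K) (eps : A -> K) lam :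
  is_deformation s eps lam -> deforms eps (ldot lam) (ldot s).
Proof. by case=> [[lB rB _ _ _ _ _] ? ? ? ? [? ?]]; split. Qed.

Lemma deforms_rdot (s : dialg_ops D) (A : comAlgType K) (eps : A -> K) lam :
  is_deformation s eps lam -> deforms eps (rdot lam) (rdot s).
Proof. by case=> [[lB rB _ _ _ _ _] ? ? ? ? [? ?]]; split. Qed.

Section Pushout.
Variables (A A' : comAlgType K) (phi : {lrmorphism A -> A'}).
Variables (eps : A -> K) (m : tensor A D -> tensor A D -> tensor A D).
Variable n : D -> D -> D.
Hypothesis mD : deforms eps m n.
Local Notation bc := (@base_change K D A A' phi).

(** Base change is multiplicative: this is [pushout_prodE] with scalars 1. *)
Lemma pushout_prod_base_change l1 l2 :
  pushout_prod phi m (bc l1) (bc l2) = bc (m l1 l2).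
Proof.
case: mD => mB mZl mZr _; have := pushout_prodE phi mB mZl mZr 1 1 l1 l2.
by rewrite mulr1 !tact1.
Qed.

Lemma pushout_prod_tens a1 x1 a2 x2 :
  pushout_prod phi m (tens a1 x1) (tens a2 x2) =
  tact (a1 * a2) (bc (m (tens 1 x1) (tens 1 x2))).
Proof.
case: mD => mB mZl mZr _; rewrite -(pushout_prodE phi mB mZl mZr).
by rewrite !base_change_tens !rmorph1 !tact_tens !mulr1.
Qed.

Lemma pushout_prod_tens1 x1 x2 :
  pushout_prod phi m (tens 1 x1) (tens 1 x2) = bc (m (tens 1 x1) (tens 1 x2)).
Proof. by rewrite pushout_prod_tens mulr1 tact1. Qed.

(** The push-out product depends on [m] only through the base changes of the
    products of the elements [tens 1 x], and these agree on the two sides. *)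
Lemma pushout_prod_comp (A'' : comAlgType K) (phi' : {lrmorphism A' -> A''}) :
  pushout_prod phi' (pushout_prod phi m) = pushout_prod (phi' \o phi) m.
Proof.
apply/funext => l1; apply/funext => l2.
congr (tlift _ l1); apply/funext => a1; apply/funext => x1.
congr (tlift _ l2); apply/funext => a2; apply/funext => x2.
by congr (tact _); rewrite -base_change_comp -pushout_prod_tens1.
Qed.

(** For surjective [phi], the push-out is a quotient of the given structure, so
    it inherits its properties; automorphisms and the projection of an
    extension are of this kind. *)
Lemma pushout_prod_deforms (eps' : A' -> K) :
  scalar eps -> scalar eps' -> (forall a, eps' (phi a) = eps a) ->
  (forall a', exists a, phi a = a') ->
  deforms eps' (pushout_prod phi m) n.
Proof.
(* As every element of the target is a base change, each property can be
   checked on base changes, where the new product is the image of the old. *)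
move=> epsL eps'L e phi_surj; have bcW := base_change_surj (D := D) phi_surj.
have bcL := base_change_linear (D := D) phi; have pE := pushout_prod_base_change.
case: (mD) => mB mZl mZr mE; split.
- split=> [l2 c l1 l1'|l1 c l2 l2'];
    have [k1 <-] := bcW l1; have [k2 <-] := bcW l2.
    have [k1' <-] := bcW l1'; rewrite -bcL !pE (mB.1 k2) /=; exact: bcL.
  have [k2' <-] := bcW l2'; rewrite -bcL !pE (mB.2 k1) /=; exact: bcL.
- move=> a l1 l2; have [k1 <-] := bcW l1; have [k2 <-] := bcW l2.
  have := pushout_prodE phi mB mZl mZr a 1 k1 k2.
  by rewrite mulr1 tact1 pE.
- move=> a l1 l2; have [k1 <-] := bcW l1; have [k2 <-] := bcW l2.
  have := pushout_prodE phi mB mZl mZr 1 a k1 k2.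
  by rewrite mul1r tact1 pE.
- move=> l1 l2; have [k1 <-] := bcW l1; have [k2 <-] := bcW l2.
  by rewrite pE /tens_aug !(tcontract_base_change _ epsL eps'L e); exact: mE.
Qed.

End Pushout.

End DeformedProducts.

Section PushoutDeformation.
Variables (K : fieldType) (D : lmodType K) (s : dialg_ops D).
Variables (A A' : comAlgType K) (phi : {lrmorphism A -> A'}).
Variables (eps : A -> K) (lam : dialg_ops (tensor A D)).
Hypothesis lamD : is_deformation s eps lam.

Lemma pushout_comp (A'' : comAlgType K) (phi' : {lrmorphism A' -> A''}) :
  pushout phi' (pushout phi lam) = pushout (phi' \o phi) lam.
Proof.
rewrite /pushout /= (pushout_prod_comp _ (deforms_ldot lamD)).
by rewrite (pushout_prod_comp _ (deforms_rdot lamD)).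
Qed.

Lemma pushout_deformation (eps' : A' -> K) :
  scalar eps -> scalar eps' -> (forall a, eps' (phi a) = eps a) ->
  (forall a', exists a, phi a = a') ->
  is_deformation s eps' (pushout phi lam).
Proof.
move=> epsL eps'L e phi_surj; have bcW := base_change_surj (D := D) phi_surj.
have lD := deforms_ldot lamD; have rD := deforms_rdot lamD.
have [lB lZl lZr lE] := pushout_prod_deforms lD epsL eps'L e phi_surj.
have [rB rZl rZr rE] := pushout_prod_deforms rD epsL eps'L e phi_surj.
have lP := pushout_prod_base_change phi lD.
have rP := pushout_prod_base_change phi rD.
have [lamA _ _ _ _ _] := lamD; split=> //; split=> //= l1 l2 l3;
  have [k1 <-] := bcW l1; have [k2 <-] := bcW l2; have [k3 <-] := bcW l3;
  rewrite !(lP, rP); congr base_change.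
- exact: dialg_ll.
- exact: dialg_lr.
- exact: dialg_rl.
- exact: dialg_lr'.
- exact: dialg_rr.
Qed.

End PushoutDeformation.

Lemma deformation_equiv_refl (K : fieldType) (D : lmodType K)
    (A : comAlgType K) (eps : A -> K) (lam : dialg_ops (tensor A D)) :
  deformation_equiv eps lam lam.
Proof. by exists id; split=> //; exists id. Qed.

(** * The infinitesimal part of a deformation along a derivation *)

Section Variation.
Variables (K : fieldType) (A : comAlgType K) (eps : {lrmorphism A -> K^o}).
Variables (D : lmodType K) (h : {scalar A}).
Hypothesis hD : derivation eps h.

Lemma lrmorphism_scalar : scalar (eps : A -> K).
Proof. by move=> c a b; rewrite linearP. Qed.
Lemma scalar_form_scalar : scalar h.
Proof. by move=> c a b; rewrite linearP. Qed.

Local Notation E := (@tens_aug K D A eps).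
Local Notation H := (@tcontract K D A h).
Local Notation EL := (tcontract_linear (D := D) lrmorphism_scalar).
Local Notation HL := (tcontract_linear (D := D) scalar_form_scalar).

Lemma derivation1 : h 1 = 0.
Proof.
have e1 : eps 1 = 1 :> K := rmorph1 eps.
have /eqP := hD 1 1; rewrite e1 !mulr1 mul1r.
by rewrite -subr_eq subrr eq_sym => /eqP.
Qed.

Lemma tens_aug_tens1 x : E (tens 1 x) = x.
Proof.
rewrite /tens_aug tcontract_tens ?rmorph1 ?scale1r //.
exact: lrmorphism_scalar.
Qed.

Lemma tens_aug_act a l : E (tact a l) = eps a *: E l.
Proof.
move: l; apply: tens_linear_ext => [c u v|c u v|b d].
- by rewrite tact_linear [E _]EL.
- by rewrite [E _]EL scalerDr !scalerA mulrC.
- rewrite tact_tens /tens_aug !(tcontract_tens lrmorphism_scalar).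
  by rewrite scalerA rmorphM.
Qed.

Lemma contract_tens1 x : H (tens 1 x) = 0.
Proof.
by rewrite tcontract_tens; [rewrite derivation1 scale0r | exact: scalar_form_scalar].
Qed.

(** Leibniz rule for [h (x) id], with respect to the action of the base. *)
Lemma contract_act a l : H (tact a l) = eps a *: H l + h a *: E l.
Proof.
move: l; apply: tens_linear_ext => [c u v|c u v|b d].
- by rewrite tact_linear HL.
- rewrite HL [E _]EL !scalerDr !scalerA addrACA -!(mulrC c) -!scalerA.
  by rewrite -!scalerDr.
- rewrite tact_tens (tcontract_tens scalar_form_scalar).
  rewrite (tcontract_tens scalar_form_scalar) /tens_aug.
  by rewrite (tcontract_tens lrmorphism_scalar) hD scalerDl !scalerA.
Qed.

(** [alpha lam h] is this map for the left product at the tree [21], and for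
    the right product at [12]. *)
Definition variation (m : tensor A D -> tensor A D -> tensor A D) (x y : D) : D :=
  H (m (tens 1 x) (tens 1 y)).

Lemma variation_bilinear m : bilin m -> bilin (variation m).
Proof.
move=> mB; have t1L : linear (fun x : D => tens (1 : A) x).
  by move=> c x y; exact: (tens_bilinear A D).2.
exact: (comp_bilinear mB HL t1L t1L).
Qed.

(** Leibniz rule for [h (x) id], with respect to a deformed product: up to the
    correction [variation], it is a derivation over [eps (x) id]. By
    bilinearity it is enough to compare on [a (x) x] and [b (x) y], where the
    scalars move out of the product and [contract_act] applies to each. *)
Lemma contract_prod (m : tensor A D -> tensor A D -> tensor A D) n l1 l2 :
  deforms eps m n -> bilin n ->
  H (m l1 l2) = n (H l1) (E l2) + n (E l1) (H l2) + variation m (E l1) (E l2).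
Proof.
case=> mB mZl mZr mE nB; move: l1 l2; apply: tens_bilinear_ext.
- exact: (comp_bilinear (k := id) (k' := id) mB HL).
- apply: add_bilinear; first apply: add_bilinear.
  + exact: (comp_bilinear (g := id) nB _ HL EL).
  + exact: (comp_bilinear (g := id) nB _ EL HL).
  + exact: (comp_bilinear (g := id) (variation_bilinear mB) _ EL EL).
- move=> a x b y; rewrite (tens_act a) (tens_act b) mZl mZr !contract_act.
  rewrite !tens_aug_act !tens_aug_tens1 !contract_tens1 !scaler0 !add0r.
  rewrite [E _]mE !tens_aug_tens1 -/(variation m x y).
  rewrite !(linZ (nB.1 _)) !(linZ (nB.2 _)).
  rewrite (linZ ((variation_bilinear mB).1 _)) (linZ ((variation_bilinear mB).2 _)).
  by rewrite scalerDr !scalerA addrC [X in _ + X = _]addrC addrA.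
Qed.

(** The cocycle identity of one tree. All five dialgebra axioms have the form
    [(x o2 y) o1 z = x o3 (y o4 z)]; apply [h (x) id] to this identity for
    [1 (x) x], [1 (x) y], [1 (x) z], which [h (x) id] kills, and expand both
    sides by [contract_prod]. *)
Lemma variation_assoc m1 m2 m3 m4 n1 n2 n3 n4 x y z :
  deforms eps m1 n1 -> deforms eps m2 n2 ->
  deforms eps m3 n3 -> deforms eps m4 n4 -> bilin n1 -> bilin n3 ->
  (forall l1 l2 l3, m1 (m2 l1 l2) l3 = m3 l1 (m4 l2 l3)) ->
  n1 (variation m2 x y) z + variation m1 (n2 x y) z =
  n3 x (variation m4 y z) + variation m3 x (n4 y z).
Proof.
move=> d1 d2 d3 d4 nB1 nB3 /(_ (tens 1 x) (tens 1 y) (tens 1 z)).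
move=> /(congr1 H); rewrite !(contract_prod _ _ d1 nB1, contract_prod _ _ d3 nB3).
rewrite !contract_tens1 (lin0 (nB1.2 _)) (lin0 (nB3.1 _)) addr0 add0r.
by rewrite (deforms_aug d2) (deforms_aug d4) !tens_aug_tens1.
Qed.

End Variation.

(** * The cocycle of a deformation *)

Section Cocycle.
Variables (K : fieldType) (D : lmodType K) (s : dialg_ops D).

Lemma coboundary2E (f : cochain D 2) (y : Y 3) (a : {ffun 'I_3 -> D}) :
  let i1 : 'I_4 := lift ord0 ord0 in let i2 : 'I_4 := lift ord0 (lift ord0 ord0) in
  let a1 := a ord0 in let a2 := a (lift ord0 ord0) in let a3 := a ord_max in
  let o := @leaf_op K D s 2 y in let fd i := f (@face 2 y i) in
  coboundary s f y a =
    o ord0 a1 (fd ord0 (pair2 a2 a3)) - fd i1 (pair2 (o i1 a1 a2) a3)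
  + fd i2 (pair2 a1 (o i2 a2 a3)) - o ord_max (fd ord_max (pair2 a1 a2)) a3.
Proof.
move=> i1 i2 a1 a2 a3 o fd; rewrite /coboundary !big_ord_recl big_ord0 addr0.
have i3 : lift ord0 (lift ord0 (lift ord0 ord0)) = ord_max :> 'I_4.
  exact/val_inj.
have pairE (g : {ffun 'I_2 -> D}) : g = pair2 (g ord0) (g ord_max).
  apply/ffunP => j; rewrite ffunE; case: eqP => [-> //|/eqP j0].
  by congr (g _); apply/val_inj; case: j j0 => [[|[|]]].
rewrite {}i3 /coface /=.
rewrite [X in leaf_op _ _ ord0 _ (f _ X)]pairE.
rewrite [X in leaf_op _ _ ord_max (f _ X)]pairE.
rewrite [X in f (face y (lift ord0 ord0)) X]pairE.
rewrite [X in f (face y (lift ord0 (lift ord0 ord0))) X]pairE !ffunE /=.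
have w0 : widen_ord (leqnSn 2) ord0 = ord0 by exact/val_inj.
have w1 : widen_ord (leqnSn 2) ord_max = lift ord0 ord0 by exact/val_inj.
have l1 : lift ord0 (ord_max : 'I_2) = ord_max by exact/val_inj.
have s2 : (-1) ^+ 2 = 1 :> K by rewrite -signr_odd.
have s3 : (-1) ^+ 3 = -1 :> K by rewrite -signr_odd.
have b1 : bump 0 0 = 1%N by [].
have b2 : bump 0 1 = 2%N by [].
rewrite w0 w1 l1 b1 b2 s2 s3 expr0 expr1.
by rewrite !scaleN1r !scale1r !addrA.
Qed.

Lemma vertices1 t : vertices t = 1%N -> t = Graft Leaf Leaf.
Proof. by case: t => [|[|? ?] [|? ?]]. Qed.

Lemma vertices2 t : vertices t = 2%N -> t = sval tree21 \/ t = sval tree12.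
Proof.
case: t => [|[|l1 l2] r] //= [vr]; first by left; rewrite (vertices1 vr).
right; case: r vr => [|? ?]; last by rewrite /= addnS.
by rewrite addn0 => vl; rewrite (@vertices1 (Graft l1 l2)) //= vl.
Qed.

Lemma vertices3 t : vertices t = 3%N ->
  (t = Graft Leaf (sval tree21) \/ t = Graft Leaf (sval tree12)) \/
  t = Graft (Graft Leaf Leaf) (Graft Leaf Leaf) \/
  t = Graft (sval tree21) Leaf \/ t = Graft (sval tree12) Leaf.
Proof.
case: t => [|[|l1 l2] [|r1 r2]] //= [vt]; [left|do 2 right|right; left].
- by case: (@vertices2 (Graft r1 r2) (congr1 S vt)) => ->; [left|right].
- rewrite addn0 in vt.
  by case: (@vertices2 (Graft l1 l2)) => [|->|->]; [rewrite /= vt|left|right].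
- move: vt; rewrite addnS => -[/eqP]; rewrite addn_eq0 => /andP[/eqP vl /eqP vr].
  by rewrite (@vertices1 (Graft l1 l2)) /= ?vl // (@vertices1 (Graft r1 r2)) /= ?vr.
Qed.

Section Alpha.
Hypothesis sD : is_dialgebra s.
Variables (A : comAlgType K) (eps : {lrmorphism A -> K^o}).
Variables (lam : dialg_ops (tensor A D)) (h : {scalar A}).
Hypothesis lamD : is_deformation s eps lam.
Hypothesis hD : derivation eps h.

Lemma alpha_multilinear : multilinear (alpha lam h).
Proof.
have [lB rB _ _ _ _ _] := deformation_dialgebra lamD.
move=> y a i c u v.
(* Decide which of the two arguments varies, so that [upd] computes. *)
have -> : i = if i == ord0 then ord0 else ord_max.
  by case: eqP => // /eqP i0; apply/val_inj; case: i i0 => [[|[|]]].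
have vB m : bilin m -> bilin (variation h m) by exact: variation_bilinear.
case: y => -[//|[|? ?] r] yP /=; case: eqP => _; rewrite /alpha /= !ffunE /=.
- exact: ((vB _ _ lB).1 (a ord_max) c u v).
- exact: ((vB _ _ lB).2 (a ord0) c u v).
- exact: ((vB _ _ rB).1 (a ord_max) c u v).
- exact: ((vB _ _ rB).2 (a ord0) c u v).
Qed.

(** The five trees with three vertices correspond to the five axioms of a
    dialgebra, each giving one instance of [variation_assoc]. *)
Lemma alpha_cocycle : cocycle s (alpha lam h).
Proof.
split; first exact: alpha_multilinear.
have dl := deforms_ldot lamD; have dr := deforms_rdot lamD.
have [lB rB _ _ _ _ _] := sD.
have [_ _ Lll Llr Lrl Llr' Lrr] := deformation_dialgebra lamD.
have four_terms (u v w z : D) : u + z = w + v -> w - z + v - u = 0.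
  by move=> e; rewrite (addrAC w) -e addrK subrr.
move=> y a; rewrite coboundary2E; apply: four_terms.
case: y => t tP; have /= := eqP tP; case/vertices3 => [[]|[|[]]] e; subst t;
  rewrite /leaf_op /alpha /leaf_is_left /= !ffunE /=.
- exact: (variation_assoc hD _ _ _ dl dl dl dl lB lB).
- exact: (variation_assoc hD _ _ _ dl dl dl dr lB lB).
- exact: (variation_assoc hD _ _ _ dl dr dr dl lB rB).
- exact: (variation_assoc hD _ _ _ dr dl dr dr rB rB).
- exact: (variation_assoc hD _ _ _ dr dr dr dr rB rB).
Qed.

End Alpha.

Lemma coboundary0 (sD : is_dialgebra s) n (y : Y n.+1) a :
  coboundary s (fun (_ : Y n) _ => 0) y a = 0.
Proof.
have [lB rB _ _ _ _ _] := sD.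
rewrite /coboundary big1 // => i _; rewrite /coface /leaf_op.
rewrite (lin0 (lB.1 _)) (lin0 (lB.2 _)) (lin0 (rB.1 _)) (lin0 (rB.2 _)).
by rewrite !if_same scaler0.
Qed.

Lemma HYclass_refl (sD : is_dialgebra s) n (f g : cochain D n.+1) :
  cocycle s g -> (forall y a, f y a = g y a) -> HYclass s f g.
Proof.
move=> gZ fg; split=> //; exists (fun _ _ => 0).
  by move=> y a i c u v; rewrite scaler0 addr0.
by move=> y a; rewrite fg subrr coboundary0.
Qed.

End Cocycle.

(** * Passage to the quotient by the square of the maximal ideal *)

Section Jet.
Variables (K : fieldType) (A : comAlgType K) (eps : {lrmorphism A -> K^o}).

Fact jet_pi_linear : linear (jet_pi eps).
Proof. by move=> c a b; rewrite jet_piD jet_piZ. Qed.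
(* This brings the projection under the results on push-outs along algebra
   morphisms. *)
HB.instance Definition _ :=
  GRing.isLinear.Build K A (jet eps) *:%R (jet_pi eps) jet_pi_linear.
HB.instance Definition _ :=
  GRing.isMonoidMorphism.Build A (jet eps) (jet_pi eps)
    (jet_pi1 eps, @jet_piM K A eps).

Variables (h : {scalar A}) (D : lmodType K) (s : dialg_ops D).
Variable lam : dialg_ops (tensor A D).
Hypothesis hD : derivation eps h.
Hypothesis lamD : is_deformation s eps lam.

(** [tangent] goes through an arbitrary choice of representatives; linearity
    holds because [h] vanishes on the square of the maximal ideal. *)
Lemma tangent_scalar : scalar (tangent h : jet eps -> K).
Proof.
move=> c x y; rewrite -[x]jet_reprK -[y]jet_reprK.
by rewrite -jet_pi_linear !tangentE // linearP.
Qed.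

(** Reducing [lam] modulo the square of the maximal ideal does not affect the
    cocycle, since [h] factors through the reduction. *)
Lemma alpha_jet y a :
  alpha (pushout (jet_pi eps) lam) (tangent h) y a = alpha lam h y a.
Proof.
have hS := scalar_form_scalar h.
have e b : tangent h (jet_pi eps b) = h b by rewrite tangentE.
case: y => -[|[|? ?] r] yP; rewrite /alpha /=.
- rewrite (pushout_prod_tens1 _ (deforms_rdot lamD)).
  exact: (tcontract_base_change _ hS tangent_scalar e).
- rewrite (pushout_prod_tens1 _ (deforms_ldot lamD)).
  exact: (tcontract_base_change _ hS tangent_scalar e).
- rewrite (pushout_prod_tens1 _ (deforms_rdot lamD)).
  exact: (tcontract_base_change _ hS tangent_scalar e).
Qed.

Lemma differential_alpha :
  is_dialgebra s -> differential eps s lam h (alpha lam h).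
Proof.
by move=> sD; exact: (HYclass_refl sD (alpha_cocycle sD lamD hD) alpha_jet).
Qed.

End Jet.

(** * Automorphisms of an extension acting on lifts *)

Section ExtensionAutomorphism.
Variables (K : fieldType) (A : comAlgType K) (eps : {lrmorphism A -> K^o}).
Variables (B : comAlgType K) (i : {linear K^o -> B}) (p : {lrmorphism B -> A}).
Hypothesis extB : is_extension eps i p.
Variables (r : {lrmorphism B -> B}) (h : {scalar A}) (D : lmodType K).
Hypothesis rE : forall b, r b = b + i (h (p b)).

Local Notation aug := (ext_aug eps p).
Local Notation I := (@ext_incl K B i D).

Lemma ext_aug_scalar : scalar aug.
Proof. by move=> c x y; rewrite /ext_aug !linearP. Qed.

Lemma ext_incl_linear : linear I.
Proof. by move=> c x y; exact: (tens_bilinear B D).2. Qed.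

Lemma tens_ext_incl k (x : D) : tens (i k) x = I (k *: x).
Proof.
rewrite (linZ ext_incl_linear) /ext_incl -(linZ ((tens_bilinear B D).1 x)).
by rewrite -linearZ /= [_ *: _]mulr1.
Qed.

Lemma tact_ext_incl b (x : D) : tact b (I x) = I (aug b *: x).
Proof. by rewrite tact_tens (ext_module extB) mulr1 tens_ext_incl. Qed.

(** [r = id + i h p], tensored with [D]. *)
Lemma base_change_automorphism (l : tensor B D) :
  base_change r l = l + I (tcontract h (base_change p l)).
Proof.
move: l; apply: tens_linear_ext => [|c u v|b x].
- exact: base_change_linear.
- rewrite base_change_linear tcontract_linear; last exact: scalar_form_scalar.
  by rewrite ext_incl_linear scalerDr addrACA.
- rewrite !base_change_tens tcontract_tens; last exact: scalar_form_scalar.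
  by rewrite rE -tens_ext_incl (linD ((tens_bilinear B D).1 x)).
Qed.

Hypothesis autr : is_ext_automorphism i p r.

Lemma ext_aug_automorphism b : aug (r b) = aug b.
Proof. by case: autr => _ _ pr; rewrite /ext_aug pr. Qed.

Lemma automorphism_surj b : exists b', r b' = b.
Proof. by case: autr => -[g _ gK] _ _; exists (g b). Qed.

(** On [b1 (x) x1] and [b2 (x) x2], both products are [b1 * b2] times the product
    of [1 (x) x1] and [1 (x) x2], followed by [r (x) id] for the push-out.
    By [base_change_automorphism] the extra term is [i h p] of this product,
    and [b1 * b2] acts on the image of [i] through its augmentation. *)
Lemma pushout_prod_difference m n (l1 l2 : tensor B D) :
  deforms aug m n ->
  pushout_prod r m l1 l2 - m l1 l2 =
  I (variation h (pushout_prod p m) (tens_aug aug l1) (tens_aug aug l2)).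
Proof.
move=> mD; have EL := tcontract_linear (D := D) ext_aug_scalar.
have epsL := lrmorphism_scalar eps.
have rmD := pushout_prod_deforms mD ext_aug_scalar ext_aug_scalar
  ext_aug_automorphism automorphism_surj.
have pmD := pushout_prod_deforms mD ext_aug_scalar epsL
  (fun=> erefl) (ext_surj extB).
apply/eqP; rewrite subr_eq addrC; apply/eqP; move: l1 l2.
apply: tens_bilinear_ext => [||b1 x1 b2 x2].
- exact: deforms_bilinear rmD.
- apply: add_bilinear; first exact: deforms_bilinear mD.
  have vB := variation_bilinear h (deforms_bilinear pmD).
  exact: (comp_bilinear vB ext_incl_linear EL EL).
- rewrite (pushout_prod_tens _ mD) base_change_automorphism.
  rewrite -(pushout_prod_tens1 p mD) (linD (tact_linear _)) tact_ext_incl.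
  have [_ mZl mZr _] := mD.
  rewrite (tens_act b1) (tens_act b2) mZl mZr -!tens_act.
  have [vl vr] := variation_bilinear h (deforms_bilinear pmD).
  rewrite /tens_aug !(tcontract_tens ext_aug_scalar).
  rewrite (linZ (vl _)) (linZ (vr _)) scalerA /variation.
  by rewrite tact_mul {1}/ext_aug !rmorphM.
Qed.

Variables (s : dialg_ops D) (lam : dialg_ops (tensor A D)).
Variable mu : dialg_ops (tensor B D).
Hypothesis liftmu : lifts eps p s lam mu.

Lemma lifts_automorphism : lifts eps p s lam (pushout r mu).
Proof.
have [muD <-] := liftmu; split.
  exact: (pushout_deformation muD ext_aug_scalar ext_aug_scalar
    ext_aug_automorphism automorphism_surj).
rewrite (pushout_comp _ muD).
have -> : p \o r = p :> (B -> A); last by [].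
by apply/funext; case: autr.
Qed.

Lemma difference_automorphism :
  difference eps i p (pushout r mu) mu (alpha lam h).
Proof.
have [muD <-] := liftmu; move=> l1 l2; rewrite /alpha /= !ffunE /=.
split; first exact: (pushout_prod_difference _ _ (deforms_ldot muD)).
exact: (pushout_prod_difference _ _ (deforms_rdot muD)).
Qed.

End ExtensionAutomorphism.

(** * The comparison of the two operations *)

Theorem proposition7p2 (K : fieldType) (charK : [pchar K] =i pred0)
    (D : lmodType K) (s : dialg_ops D) (dialgD : is_dialgebra s)
    (A : comAlgType K) (fdA : finite_dimensional A)
    (eps : {lrmorphism A -> K^o}) (locA : local_with (aug_ideal eps))
    (lam : dialg_ops (tensor A D)) (deflam : is_deformation s eps lam)
    (B : comAlgType K) (i : {linear K^o -> B}) (p : {lrmorphism B -> A})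
    (extB : is_extension eps i p)
    (f : A -> A -> K) (cocf : is_harrison_cocycle2 eps f)
    (classB : extension_class i p f)
    (r : {lrmorphism B -> B}) (autr : is_ext_automorphism i p r)
    (h : {scalar A}) (derh : derivation eps h)
    (rh : forall b, r b = b + i (h (p b)))
    (mu : dialg_ops (tensor B D)) (liftmu : lifts eps p s lam mu) :
  [/\ lifts eps p s lam (pushout r mu),
      exists2 psi : cochain D 2%N,
        difference eps i p (pushout r mu) mu psi &
        differential eps s lam h psi
    & HY2_sends eps i p s lam (differential eps s lam h) mu (pushout r mu)].
Proof.
have rmu_lift := lifts_automorphism autr liftmu.
have rmu_diff := difference_automorphism extB rh autr liftmu.
have alpha_dlam := differential_alpha derh deflam dialgD.
split=> //; first by exists (alpha lam h).
exists (alpha lam h), (pushout r mu); split=> //.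
exact: deformation_equiv_refl.
Qed.
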